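(* Reversing a Markovian network does not affect the effective resistance: if a Markovian electric network on a finite connected graph $G=(V,E)$ has parameters $(R_{xy},\lambda_{xy})_{x\sim y}$ and its reversed network is the one with parameters $(R_{xy},1/\lambda_{xy})_{x\sim y}$, then for any disjoint non-empty $A,B\subset V$, $$\widehat{R^{\text{eff}}_{AB}}=R^{\text{eff}}_{AB},$$ where $R^{\text{eff}}_{AB}$ and $\widehat{R^{\text{eff}}_{AB}}$ are the effective resistances between $A$ and $B$ in the original and in the reversed network, respectively.
   Context: Graphs are finite, connected and undirected, and loops are allowed; $x\sim y$ means that $x$ and $y$ are joined by an edge, with $x\sim x$ exactly when $x$ has a loop. An electric network on $G=(V,E)$ consists of resistances $R_{xy}=R_{yx}>0$ and amplifier parameters $\lambda_{xy}>0$ with $\lambda_{yx}=1/\lambda_{xy}$, given for all $x\sim y$, with $\lambda_{xx}=1$ on loops. Put $C_{xy}=1/R_{xy}$, $\gamma_{xy}=\sqrt{\lambda_{xy}}=1/\gamma_{yx}$, $D_{xy}=\frac{2\gamma_{xy}}{1+\lambda_{xy}}C_{xy}=D_{yx}$. The network is called Markovian if $\sum_{z\sim x}D_{xz}\gamma_{xz}=\sum_{z\sim x}D_{xz}\gamma_{zx}$ for all $x\in V$; the reversed network of a Markovian network (same resistances, $\hat\lambda_{xy}=\lambda_{yx}=1/\lambda_{xy}$) is again Markovian. Potentials $(u_x)_{x\in V}$ and currents are related by $i_{xy}=D_{xy}(\gamma_{yx}u_x-\gamma_{xy}u_y)$ for $x\sim y$. The incoming current to vertex $x$ is $i_x=\sum_{y\sim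 x}i_{xy}$; $x$ is free if $i_x=0$. For potentials prescribed on a nonempty set of vertices, with all others free, there is a unique solution $(u,i)$. For disjoint non-empty $A,B\subset V$, hold $A$ at constant potential $U_A$, $B$ at constant potential $U_B$, with all other vertices free, and put $i_A=\sum_{x\in A}i_x$. In a Markovian network the effective resistance $R^{\text{eff}}_{AB}>0$ is the constant with $U_A-U_B=R^{\text{eff}}_{AB}\, i_A$ for all $U_A,U_B\in\mathbb R$. *)

(* Defs.v *)
From HB Require Import structures.
From mathcomp Require Import all_boot all_order all_algebra.
From mathcomp Require Import boolp classical_sets reals.
From mathcomp Require Import ring lra.

Set Implicit Arguments.
Unset Strict Implicit.
Unset Printing Implicit Defensive.

Import Order.TTheory GRing.Theory Num.Theory.

Local Open Scope ring_scope.

(* Loops are allowed: adj x x may hold. *)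
Record graph (V : finType) := Graph {
  adj :> rel V;
  adj_sym : symmetric adj;
  adj_connected : forall x y, connect adj x y
}.

(* Both parameters are total functions, but only their values on edges are
   constrained, and only these enter the sums below. *)
Record network (R : realType) (V : finType) (G : graph V) := Network {
  res : V -> V -> R;
  ampl : V -> V -> R;
  res_gt0 : forall x y, G x y -> 0 < res x y;
  res_sym : forall x y, G x y -> res y x = res x y;
  ampl_gt0 : forall x y, G x y -> 0 < ampl x y;
  ampl_inv : forall x y, G x y -> ampl y x = (ampl x y)^-1;
  ampl_loop : forall x, G x x -> ampl x x = 1
}.

Section Network.
Variables (R : realType) (V : finType) (G : graph V).
Implicit Types (N : network R G) (A B : {set V}) (u : V -> R) (x y : V).

Definition conductance N x y : R := (res N x y)^-1.

Definition gamma N x y : R := Num.sqrt (ampl N x y).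

Definition Dcond N x y : R :=
  2 * gamma N x y / (1 + ampl N x y) * conductance N x y.

Definition markovian N : Prop :=
  forall x, \sum_(z | G z x) Dcond N x z * gamma N x z
            = \sum_(z | G z x) Dcond N x z * gamma N z x.

Definition current N u x y : R :=
  Dcond N x y * (gamma N y x * u x - gamma N x y * u y).

Definition incoming N u x : R := \sum_(y | G y x) current N u x y.

Definition incoming_set N u A : R := \sum_(x in A) incoming N u x.

Definition held_at N A B (UA UB : R) u : Prop :=
  [/\ forall x, x \in A -> u x = UA,
      forall x, x \in B -> u x = UB
    & forall x, x \notin A :|: B -> incoming N u x = 0].

Definition is_eff_resistance N A B (r : R) : Prop :=
  0 < r /\ forall (UA UB : R) u,
    held_at N A B UA UB u -> UA - UB = r * incoming_set N u A.

(* xget 0 picks the element of the set, 0 being a junk value for the empty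
   set; for a Markovian network and disjoint nonempty A and B the set is a
   singleton: see eff_resistanceP and eff_resistance_unique. *)
Definition eff_resistance N A B : R :=
  xget 0 [set r | is_eff_resistance N A B r]%classic.

Lemma rev_ampl_gt0 N x y : G x y -> 0 < (ampl N x y)^-1.
Proof. by move=> Gxy; rewrite invr_gt0 ampl_gt0. Qed.

Lemma rev_ampl_inv N x y : G x y -> (ampl N y x)^-1 = (ampl N x y)^-1^-1.
Proof. by move=> Gxy; rewrite (ampl_inv N Gxy). Qed.

Lemma rev_ampl_loop N x : G x x -> (ampl N x x)^-1 = 1.
Proof. by move=> Gxx; rewrite (ampl_loop N Gxx) invr1. Qed.

Definition reverse N : network R G :=
  @Network R V G (res N) (fun x y => (ampl N x y)^-1)
    (@res_gt0 _ _ _ N) (@res_sym _ _ _ N)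
    (@rev_ampl_gt0 N) (@rev_ampl_inv N) (@rev_ampl_loop N).

Lemma gamma_gt0 N x y : G x y -> 0 < gamma N x y.
Proof. by move=> Gxy; rewrite sqrtr_gt0 ampl_gt0. Qed.

Lemma gamma_inv N x y : G x y -> gamma N y x = (gamma N x y)^-1.
Proof.
by move=> Gxy; rewrite /gamma (ampl_inv N Gxy) sqrtrV // ltW // ampl_gt0.
Qed.

Lemma Dcond_gt0 N x y : G x y -> 0 < Dcond N x y.
Proof.
move=> Gxy; have l0 := ampl_gt0 N Gxy.
rewrite /Dcond !mulr_gt0 ?gamma_gt0 // invr_gt0 ?(res_gt0 N) //.
by rewrite addr_gt0.
Qed.

Lemma gamma_reverse N x y : G x y -> gamma (reverse N) x y = gamma N y x.
Proof. by move=> Gxy; rewrite /gamma /= (ampl_inv N Gxy). Qed.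

Lemma Dcond_reverse N x y : G x y -> Dcond (reverse N) x y = Dcond N x y.
Proof.
move=> Gxy; have g0 := gamma_gt0 N Gxy.
rewrite /Dcond gamma_reverse // (gamma_inv N Gxy) /=; congr (_ * _).
have -> : ampl N x y = gamma N x y ^+ 2 by rewrite sqr_sqrtr // ltW // ampl_gt0.
by field; rewrite !gt_eqF // addr_gt0 ?exprn_gt0.
Qed.

Lemma markovian_reverse N : markovian N -> markovian (reverse N).
Proof.
move=> HN x; have E z : G z x -> G x z by rewrite adj_sym.
under eq_bigr => z Gzx do rewrite Dcond_reverse ?E // gamma_reverse ?E //.
under [RHS]eq_bigr => z Gzx do rewrite Dcond_reverse ?E // gamma_reverse //.
by rewrite HN.
Qed.

Section WellDefined.
Variable N : network R G.
Hypothesis HN : markovian N.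

Let w x y := Dcond N x y * gamma N x y.

Let w_gt0 x y : G y x -> 0 < w x y.
Proof. by rewrite adj_sym => Gxy; rewrite mulr_gt0 ?Dcond_gt0 ?gamma_gt0. Qed.

Lemma incoming_markov u x :
  incoming N u x = \sum_(y | G y x) w x y * (u x - u y).
Proof.
have -> : incoming N u x =
    (\sum_(y | G y x) Dcond N x y * gamma N y x) * u x
    - \sum_(y | G y x) w x y * u y.
  rewrite mulr_suml -sumrB; apply: eq_bigr => y _.
  by rewrite /current /w; ring.
rewrite -HN mulr_suml -sumrB; apply: eq_bigr => y _.
by rewrite /w; ring.
Qed.

Lemma incoming_affine (a b : R) u x :
  incoming N (fun z => a * u z + b) x = a * incoming N u x.
Proof.
by rewrite !incoming_markov mulr_sumr; apply: eq_bigr => y _; ring.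
Qed.

Lemma maximum_principle (S : {set V}) u : S != finset.set0 ->
    (forall x, x \notin S -> incoming N u x = 0) ->
  exists2 s, s \in S & forall x, u x <= u s.
Proof.
move=> /finset.set0Pn[s0 s0S] uS.
case: (arg_maxP u (erefl : predT s0)) => m _ umax.
have [[s sS us]|noS] := pselect (exists2 s, s \in S & u s = u m).
  by exists s => // x; rewrite us; apply: umax.
have cl : closed G [pred x | u x == u m].
  apply: intro_closed => [|x y Gxy]; first exact/sym_connect_sym/adj_sym.
  rewrite !inE => /eqP ux.
  have /uS : x \notin S by apply/negP => xS; apply: noS; exists x.
  rewrite incoming_markov => /eqP.
  have Gyx : G y x by rewrite adj_sym.
  rewrite psumr_eq0 => [/allP/(_ y)|z Gzx]; last first.
    by rewrite mulr_ge0 ?(ltW (w_gt0 _)) // subr_ge0 ux; apply: umax.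
  rewrite mem_index_enum Gyx => /(_ isT) /=.
  by rewrite mulf_eq0 gt_eqF ?w_gt0 //= subr_eq0 ux eq_sym.
case: noS; exists s0 => //; apply/eqP.
have := closed_connect cl (adj_connected G m s0).
by rewrite !inE eqxx => <-.
Qed.

Lemma minimum_principle (S : {set V}) u : S != finset.set0 ->
    (forall x, x \notin S -> incoming N u x = 0) ->
  exists2 s, s \in S & forall x, u s <= u x.
Proof.
move=> S0 uS; have [|s sS smax] :=
  @maximum_principle S (fun z => (-1) * u z + 0) S0.
  by move=> x xS; rewrite incoming_affine uS ?mulr0.
exists s => // x; have := smax x; lra.
Qed.

Let T (S : {set V}) (u : {ffun V -> R^o}) : {ffun V -> R^o} :=
  [ffun x => if x \in S then u x else incoming N u x].

Let T_linear S : linear (T S).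
Proof.
move=> a u v; apply/ffunP => x; rewrite !ffunE.
case: ifP => // _.
rewrite !incoming_markov scaler_sumr -big_split; apply: eq_bigr => y _.
by rewrite !ffunE /= /GRing.scale /=; ring.
Qed.

Lemma dirichlet_exists (S : {set V}) (f : V -> R) : S != finset.set0 ->
  exists u, (forall x, x \in S -> u x = f x) /\
            (forall x, x \notin S -> incoming N u x = 0).
Proof.
move=> S0.
pose TL : {linear {ffun V -> R^o} -> {ffun V -> R^o}} :=
  HB.pack (T S) (GRing.isLinear.Build R _ _ _ (T S) (@T_linear S)).
pose TS := linfun TL.
have TSE (u : {ffun V -> R^o}) : TS u = T S u by rewrite lfunE.
have inj : lker TS == 0%VS.
  rewrite -subv0; apply/subvP => /= u; rewrite memv_ker memv0 TSE => /eqP Tu0.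
  have uS x : x \in S -> u x = 0.
    by move=> xS; have /ffunP/(_ x) := Tu0; rewrite !ffunE xS.
  have uF x : x \notin S -> incoming N u x = 0.
    by move=> /negPf xS; have /ffunP/(_ x) := Tu0; rewrite !ffunE xS.
  have [s sS smax] := maximum_principle S0 uF.
  have [t tS tmin] := minimum_principle S0 uF.
  apply/eqP/ffunP => x; rewrite ffunE; apply/eqP; rewrite eq_le.
  by have := smax x; have := tmin x; rewrite (uS s sS) (uS t tS) => -> ->.
pose g : {ffun V -> R^o} := [ffun x => if x \in S then f x else 0].
have Tg : T S ((TS^-1)%VF g) = g by rewrite -TSE lker0_lfunVK.
exists ((TS^-1)%VF g : {ffun V -> R^o}); split=> x xS; move/ffunP/(_ x): Tg.
  by rewrite !ffunE xS.
by rewrite !ffunE (negPf xS).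
Qed.

Lemma dirichlet_unique (S : {set V}) u v : S != finset.set0 ->
    (forall x, x \in S -> u x = v x) ->
    (forall x, x \notin S -> incoming N u x = 0) ->
    (forall x, x \notin S -> incoming N v x = 0) ->
  u = v.
Proof.
move=> S0 uv uF vF.
have dF x : x \notin S -> incoming N (fun z => u z - v z) x = 0.
  move=> xS; transitivity (incoming N u x - incoming N v x).
    by rewrite !incoming_markov -sumrB; apply: eq_bigr => y _; ring.
  by rewrite uF // vF // subrr.
have [s sS /= smax] := maximum_principle S0 dF.
have [t tS /= tmin] := minimum_principle S0 dF.
apply/funext => x; have := smax x; have := tmin x.
rewrite (uv s sS) (uv t tS) !subrr; lra.
Qed.

Variables A B : {set V}.
Hypotheses (A0 : A != finset.set0) (B0 : B != finset.set0) (AB : [disjoint A & B]).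

Let AB0 : A :|: B != finset.set0.
Proof. by rewrite finset.setU_eq0 negb_and A0. Qed.

Lemma held_at_exists (UA UB : R) : exists u, held_at N A B UA UB u.
Proof.
have [u [uS uF]] :=
  @dirichlet_exists (A :|: B) (fun x => if x \in A then UA else UB) AB0.
exists u; split=> // x xP; rewrite uS ?inE ?xP ?orbT //.
by rewrite (disjointFl AB xP).
Qed.

Lemma held_at_unique (UA UB : R) u v :
  held_at N A B UA UB u -> held_at N A B UA UB v -> u = v.
Proof.
move=> [uA uB uF] [vA vB vF]; apply: (dirichlet_unique AB0) => // x.
by rewrite inE => /orP[xA|xB]; [rewrite uA ?vA|rewrite uB ?vB].
Qed.

Lemma eff_resistance_exists : exists r, is_eff_resistance N A B r.
Proof.
have [v hv] := held_at_exists 1 0; have [vA vB vF] := hv.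
have v_le1 x : v x <= 1.
  have [s + /(_ x) vx] := maximum_principle AB0 vF.
  rewrite inE => /orP[/vA|/vB] vs; move: vx; rewrite vs // => vx.
  exact: le_trans vx ler01.
have iA x : x \in A -> 0 <= incoming N v x.
  move=> xA; rewrite incoming_markov sumr_ge0 // => y Gyx.
  by rewrite mulr_ge0 ?(ltW (w_gt0 _)) // vA // subr_ge0.
have i_gt0 : 0 < incoming_set N v A.
  rewrite lt_neqAle sumr_ge0 // andbT eq_sym; apply/negP.
  rewrite psumr_eq0 // => /allP iA0.
  have [|s sB smax] := @maximum_principle B v B0.
    move=> x xB; have [xA|xA] := boolP (x \in A).
      by have := iA0 x (mem_index_enum x); rewrite xA => /eqP.
    by apply: vF; rewrite inE negb_or xA.
  have /finset.set0Pn[a aA] := A0.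
  by have := smax a; rewrite vA // vB //; lra.
exists (incoming_set N v A)^-1; split; first by rewrite invr_gt0.
move=> UA UB u hu.
have -> : u = (fun z => (UA - UB) * v z + UB).
  apply: held_at_unique hu _; split=> x xP.
  - by rewrite vA //; ring.
  - by rewrite vB //; ring.
  - by rewrite incoming_affine vF ?mulr0.
rewrite {2}/incoming_set; under eq_bigr do rewrite incoming_affine.
by rewrite -mulr_sumr mulrCA mulVf ?mulr1 ?gt_eqF.
Qed.

Lemma eff_resistance_unique r r' :
  is_eff_resistance N A B r -> is_eff_resistance N A B r' -> r = r'.
Proof.
move=> [_ hr] [_ hr']; have [v hv] := held_at_exists 1 0.
have e := hr _ _ _ hv; have e' := hr' _ _ _ hv.
have i0 : incoming_set N v A != 0.
  by apply/eqP => i0; move: e; rewrite i0; lra.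
by apply: (mulIf i0); rewrite -e -e'.
Qed.

Lemma eff_resistanceP : is_eff_resistance N A B (eff_resistance N A B).
Proof. exact: (xgetPex 0 eff_resistance_exists). Qed.

End WellDefined.
End Network.

(* Main.v *)
Require Import Defs.
From mathcomp Require Import all_boot all_order all_algebra.
From mathcomp Require Import reals.
From mathcomp Require Import ring.

(** The map sending potentials to incoming currents is linear, and reversing a
    Markovian network replaces it by its transpose.  The off-diagonal
    coefficients [- D x y * gamma x y] become [- D x y * gamma y x], which is
    transposition since [D] is symmetric; the diagonal coefficients, apart from
    the contribution of loops, which reversal leaves alone, go from
    [\sum_z D x z * gamma z x] to [\sum_z D x z * gamma x z], the same number by
    the Markov property.  This is [incoming_adjoint].

    Let [u] and [v] solve, in the network and in its reverse, the problem with
    potential 1 on [A] and 0 on [B].  Since the current produced by [u] enters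
    only at [A] and [B], where [v] is known, pairing it with [v] gives the total
    current entering at [A] ([incoming_set_pairing]).  Symmetrically, pairing
    the current produced by [v] in the reversed network with [u] gives the total
    reversed current at [A].  The two pairings agree by adjointness, and each
    total current is the inverse of the corresponding effective resistance. *)

Set Implicit Arguments.
Unset Strict Implicit.

Import GRing.Theory.
Local Open Scope ring_scope.

Lemma Dcond_sym (R : realType) (V : finType) (G : graph V)
    (N : network R G) (x y : V) : G x y -> Dcond N y x = Dcond N x y.
Proof.
move=> Gxy; have Gyx : G y x by rewrite adj_sym.
(* [D] written for the reversed network has the amplification of the edge
   [y x] in it, so the invariance of [D] under reversal is its symmetry. *)
rewrite -(Dcond_reverse N Gxy) /Dcond (gamma_reverse N Gxy) /conductance /=.
by rewrite (ampl_inv N Gxy) (res_sym N Gxy).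
Qed.

Lemma current_reverse (R : realType) (V : finType) (G : graph V)
    (N : network R G) (u : V -> R) (x y : V) : G x y ->
  current (reverse N) u x y = Dcond N x y * (gamma N x y * u x - gamma N y x * u y).
Proof.
move=> Gxy; have Gyx : G y x by rewrite adj_sym.
by rewrite /current Dcond_reverse // !gamma_reverse.
Qed.

(** The Markov property is what identifies the terms in [u x * v x] of the two
    pairings; the terms in [v x * u y] and [u x * v y] correspond by swapping
    the endpoints of every edge. *)
Lemma incoming_adjoint (R : realType) (V : finType) (G : graph V)
    (N : network R G) (HN : markovian N) (u v : V -> R) :
  \sum_x v x * incoming N u x = \sum_x u x * incoming (reverse N) v x.
Proof.
pose edge_sum f := \sum_x \sum_(y | G y x) (f x y : R).
pose diag x := \sum_(y | G y x) Dcond N x y * gamma N x y.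
have -> : \sum_x v x * incoming N u x = \sum_x u x * v x * diag x
    - edge_sum (fun x y => Dcond N x y * gamma N x y * (v x * u y)).
  rewrite -sumrB; apply: eq_bigr => x _.
  rewrite /diag HN !mulr_sumr -sumrB; apply: eq_bigr => y _.
  by rewrite /current; ring.
have -> : \sum_x u x * incoming (reverse N) v x = \sum_x u x * v x * diag x
    - edge_sum (fun x y => Dcond N x y * gamma N y x * (u x * v y)).
  rewrite -sumrB; apply: eq_bigr => x _.
  rewrite !mulr_sumr -sumrB; apply: eq_bigr => y Gyx.
  by rewrite current_reverse 1?adj_sym //; ring.
congr (_ - _); rewrite /edge_sum (exchange_big_dep xpredT) //=.
apply: eq_bigr => x _.
under eq_bigl => y do rewrite adj_sym.
by apply: eq_bigr => y Gyx; rewrite Dcond_sym 1?adj_sym // (mulrC (v y)).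
Qed.

Lemma incoming_set_pairing (R : realType) (V : finType) (G : graph V)
    (N : network R G) (A B : {set V}) (u v : V -> R) :
    (forall x, x \in A -> v x = 1) -> (forall x, x \in B -> v x = 0) ->
    (forall x, x \notin A :|: B -> incoming N u x = 0) ->
  \sum_x v x * incoming N u x = incoming_set N u A.
Proof.
move=> vA vB uF; rewrite /incoming_set [RHS]big_mkcond; apply: eq_bigr => x _.
case: ifPn => [/vA->|xA]; first by rewrite mul1r.
have [/vB->|xB] := boolP (x \in B); first by rewrite mul0r.
by rewrite uF ?mulr0 // inE negb_or xA.
Qed.

Lemma eff_resistance_incoming_set (R : realType) (V : finType) (G : graph V)
    (N : network R G) (HN : markovian N) (A B : {set V}) (u : V -> R) :
    A != set0 -> B != set0 -> [disjoint A & B] -> held_at N A B 1 0 u ->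
  eff_resistance N A B = (incoming_set N u A)^-1.
Proof.
move=> A0 B0 AB /(proj2 (eff_resistanceP HN A0 B0 AB)); rewrite subr0 => ri1.
have i0 : incoming_set N u A != 0.
  by apply/eqP => i0; move/eqP: ri1; rewrite i0 mulr0 oner_eq0.
by apply: (mulIf i0); rewrite -ri1 mulVf.
Qed.

Unset Implicit Arguments.

Theorem proposition3p8 (R : realType) (V : finType) (G : graph V)
    (N : network R G) (HN : markovian N) (A B : {set V})
    (A0 : A != set0) (B0 : B != set0) (AB : [disjoint A & B]) :
  eff_resistance (reverse N) A B = eff_resistance N A B.
Proof.
have HN' := markovian_reverse HN.
have [u hu] := held_at_exists HN A0 AB 1 0.
have [v hv] := held_at_exists HN' A0 AB 1 0.
rewrite (eff_resistance_incoming_set HN' A0 B0 AB hv).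
rewrite (eff_resistance_incoming_set HN A0 B0 AB hu).
case: hu hv => uA uB uF [vA vB vF]; congr (_^-1).
rewrite -(incoming_set_pairing uA uB vF).
rewrite -(incoming_set_pairing vA vB uF).
by rewrite (incoming_adjoint HN).
Qed.
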